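(* Let $S$ be an additively idempotent semiring, let $\mathcal{A}=(a_{ij})$ be an $n\times n$ matrix over $S$, and let $p(x)\in S[x]$ be the characteristic polynomial of $\mathcal{A}$. Then $\mathcal{A}$ satisfies the bend relations of $p(x)$. That is, writing $p(x)=\sum_{m=0}^n d_m x^m$ and $p_{\hat k}(x)=\sum_{m\neq k} d_m x^m$, one has $p_{\hat k}(\mathcal{A})=p(\mathcal{A})$ for every $k$ with $d_k\neq 0$.
   Context: Semirings are commutative, with $0$ and $1$, and satisfy $a\cdot 0=0$; additively idempotent means $a+a=a$ for all $a$. The characteristic polynomial of an $n\times n$ matrix $\mathcal{A}$ over $S$ is $p_{\mathcal{A}}(x):=\operatorname{perm}(\mathcal{A}+xI_n)$, where $\operatorname{perm}(B)=\sum_{\sigma\in\mathfrak{S}_n}\prod_{i=1}^n b_{i,\sigma(i)}$ is the permanent. The bend relations of a polynomial $f$ are the pairs $(f,f_{\hat\imath})$, for $i$ in the support of $f$, where $f_{\hat\imath}$ is obtained from $f$ by deleting the $i$-th term. A matrix $\mathcal{A}$ satisfies a relation $(f,g)$ of polynomials if $f(\mathcal{A})=g(\mathcal{A})$. *)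

(* Defs.v *)
From HB Require Import structures.
From mathcomp Require Import all_boot all_order all_fingroup all_algebra.

Set Implicit Arguments.
Unset Strict Implicit.
Unset Printing Implicit Defensive.

Import GRing.Theory.
Local Open Scope ring_scope.

Definition permanent (R : comPzSemiRingType) (n : nat) (B : 'M[R]_n) : R :=
  \sum_(s : 'S_n) \prod_(i < n) B i (s i).

(* MathComp's [char_poly] is [\det ('X%:M - A)], hence limited to rings; here
   both the determinant and the subtraction are replaced. *)
Definition perm_char_poly (S : comNzSemiRingType) (n : nat) (A : 'M[S]_n) :
    {poly S} :=
  permanent (map_mx polyC A + 'X%:M).

Definition delete_term (S : comNzSemiRingType) (k : nat) (f : {poly S}) :
    {poly S} :=
  \sum_(m < size f | m != k :> nat) f`_m *: 'X^m.

Definition bend_relation (S : comNzSemiRingType) (f : {poly S})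
    (r : {poly S} * {poly S}) : Prop :=
  exists2 k : nat, f`_k != 0 & r = (f, delete_term k f).

(* [horner_mx A f] is the value f(A), with constants c read as c%:M; it needs
   a nonempty matrix, whence the size n.+1. *)
Definition mx_satisfies (S : comNzSemiRingType) (n : nat) (A : 'M[S]_n.+1)
    (r : {poly S} * {poly S}) : Prop :=
  horner_mx A r.1 = horner_mx A r.2.

(* Main.v *)
Require Import Defs.
From mathcomp Require Import all_boot all_order all_fingroup all_algebra.
From mathcomp Require Import zify.
Import GRing.Theory.
Local Open Scope ring_scope.

(** In an additively idempotent semiring, a <= b iff a + b = b is a partial
    order for which a sum is the join of its terms.  Hence deleting d_k x^k
    from p leaves p(A) unchanged as soon as every monomial of (d_k A^k) i j
    also occurs as a monomial of (d_m A^m) i j for some m <> k.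

    Expanding the permanent, the monomials of d_k are the weights of the
    partial cycle covers: a set U of N - k indices, N being the size of A, with
    a permutation s of U ([coef_perm_char_poly]).  The monomials of (A^k) i j
    are the weights of the walks of length k from i to j.  So a monomial of
    (d_k A^k) i j is a cover together with a walk, using N edges in total.

    As in Straubing's combinatorial proof of the Cayley-Hamilton theorem, one
    cycle can always be moved between the two ([swap_cycle]).  If the walk
    meets U, the cycle of s through a common vertex is spliced into the walk.
    Otherwise the k + 1 vertices of the walk lie in the complement of U, which
    has k elements, so the walk repeats a vertex; it then contains a simple
    closed walk, which is cut out and becomes a new cycle of the cover.  Either
    way the edges used, hence the weight, are the same, while the length of the
    walk changes.  Since there are no signs to cancel, this map
    need not be an involution, so the choice of the cycle is free. *)

Set Implicit Arguments.
Unset Strict Implicit.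

(** * The order of an idempotent sum *)

Definition le_add (R : nmodType) (a b : R) : Prop := a + b = b.

Lemma le_add_trans (R : nmodType) (a b c : R) :
  le_add a b -> le_add b c -> le_add a c.
Proof. by move=> ab bc; rewrite /le_add -bc addrA ab. Qed.

Lemma le_add_sum (R : nmodType) (I : finType) (P : pred I) (F : I -> R) b :
  (forall i, P i -> le_add (F i) b) -> le_add (\sum_(i | P i) F i) b.
Proof.
move=> Fb; apply: (big_ind (fun a => le_add a b)) => //; first exact: add0r.
by move=> a a' ab a'b; rewrite /le_add -addrA a'b.
Qed.

Lemma le_sum_term (R : nmodType) (addRR : forall a : R, a + a = a)
    (I : finType) (P : pred I) (F : I -> R) i :
  P i -> le_add (F i) (\sum_(j | P j) F j).
Proof. by move=> Pi; rewrite /le_add (bigD1 i) //= addrA addRR. Qed.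

Lemma le_add_mul (R : pzSemiRingType) (a b c d : R) :
  le_add a b -> le_add c d -> le_add (a * c) (b * d).
Proof.
move=> ab cd; apply: (@le_add_trans _ _ (b * c)).
  by rewrite /le_add -mulrDl ab.
by rewrite /le_add -mulrDr cd.
Qed.

(** * Walks and powers of a matrix *)

Fixpoint walk_weight (R : pzSemiRingType) (T : Type) (a : T -> T -> R)
    (x : T) (p : seq T) : R :=
  if p is y :: q then a x y * walk_weight a y q else 1.

Lemma walk_weight_cat (R : pzSemiRingType) (T : Type) (a : T -> T -> R) x p q :
  walk_weight a x (p ++ q) = walk_weight a x p * walk_weight a (last x p) q.
Proof. by elim: p x => [|y p IHp] x /=; rewrite ?mul1r // IHp mulrA. Qed.

Lemma walk_weight_nth (R : pzSemiRingType) (T : Type) (a : T -> T -> R) x0 x p :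
  walk_weight a x p =
  \prod_(0 <= k < size p) a (nth x0 (x :: p) k) (nth x0 p k).
Proof.
elim: p x => [|y p IHp] x /=; first by rewrite big_geq.
by rewrite big_nat_recl //= IHp.
Qed.

(** Puts the weight of a simple closed walk in the form taken by the weight of
    a cycle inside a cover, where it is a product over vertices. *)
Lemma closed_walk_weight (R : pzSemiRingType) (T : eqType) (a : T -> T -> R)
    x c :
  uniq (x :: c) ->
  walk_weight a x (rcons c x) = \prod_(y <- x :: c) a y (next (x :: c) y).
Proof.
move=> Uc; rewrite (walk_weight_nth _ x) size_rcons (big_nth x).
apply: eq_big_nat => k; rewrite leq0n ltnS andTb => le_k_c.
rewrite next_nth mem_nth // index_uniq // -rcons_cons.
(* At the last index [next] wraps around to [x], which is the default value
   of the [nth] over [c]. *)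
rewrite !nth_rcons /= ltnS le_k_c; congr (a _ _).
by case: ltngtP le_k_c => // k_c _; rewrite nth_default // k_c.
Qed.

Lemma walk_weight_le_expr (S : pzSemiRingType) (addSS : forall a : S, a + a = a)
    n (A : 'M[S]_n.+1) i p :
  le_add (walk_weight A i p) ((A ^+ size p) i (last i p)).
Proof.
elim: p i => [|l p IHp] i /=; first by rewrite expr0 mxE eqxx /le_add addSS.
rewrite exprS mxE.
apply: (@le_add_trans _ _ (A i l * (A ^+ size p) l (last l p))).
  by apply: le_add_mul (IHp l); rewrite /le_add addSS.
exact: (le_sum_term addSS (fun l => A i l * (A ^+ size p) l _)).
Qed.

(** The entries of A^k are joins of walk weights, stated as an elimination rule
    so that the walks of length k need not be enumerated.  The factor [c] makes
    the induction go through: it collects the edges already traversed. *)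
Lemma expr_le_walk_weight (S : pzSemiRingType) n (A : 'M[S]_n.+1) k i j c b :
  (forall p, size p = k -> last i p = j -> le_add (c * walk_weight A i p) b) ->
  le_add (c * (A ^+ k) i j) b.
Proof.
elim: k i c => [|k IHk] i c le_b.
  rewrite expr0 mxE; case: eqP => [ij | _]; first exact: (le_b [::]).
  by rewrite mulr0n mulr0 /le_add add0r.
rewrite exprS mxE mulr_sumr; apply: le_add_sum => l _; rewrite mulrA.
apply: IHk => p size_p last_p; rewrite -mulrA.
by apply: (le_b (l :: p)); rewrite /= ?size_p.
Qed.

(** * Partial cycle covers and the characteristic polynomial *)

Definition cover_weight (R : comPzSemiRingType) (T : finType) (a : T -> T -> R)
    (U : {set T}) (s : {perm T}) : R :=
  \prod_(x in U) a x (s x).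

(** Each factor of the permanent is A i (s i), plus X when s fixes i.  Choosing
    the set U where the first summand is taken gives a nonzero term only if s
    moves no index outside U, and that term has degree the cardinal of the
    complement of U. *)
Lemma coef_perm_char_poly (S : comNzSemiRingType) n (A : 'M[S]_n) m :
  (perm_char_poly A)`_m =
  \sum_(sU : 'S_n * {set 'I_n} | perm_on sU.2 sU.1 && (#|sU.2| + m == n)%N)
     cover_weight A sU.2 sU.1.
Proof.
rewrite /perm_char_poly /permanent coef_sum [RHS]big_mkcond /=.
rewrite -(pair_bigA _ (fun (s : 'S_n) (U : {set 'I_n}) =>
  if perm_on U s && (#|U| + m == n)%N then cover_weight A U s else 0)) /=.
apply: eq_bigr => s _; under eq_bigr => i _ do rewrite !mxE.
rewrite bigA_distr coef_sum; apply: eq_bigr => U _.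
rewrite (bigID (mem U)) /=.
under eq_bigr => i iU do rewrite iU.
under [X in _ * X]eq_bigr => i iU do rewrite (negPf iU).
rewrite -rmorph_prod /= coefCM.
have [sU | /subsetPn[i]] := boolP (perm_on U s); last first.
  rewrite inE => si iU.
  have -> : \prod_(j | j \notin U) ('X *+ (j == s j)) = 0 :> {poly S}.
    by rewrite (bigD1 i) //= eq_sym (negPf si) mulr0n mul0r.
  by rewrite coef0 mulr0.
rewrite (eq_bigr (fun=> 'X)); last by move=> i iU; rewrite (out_perm sU) ?eqxx.
have -> : \prod_(i | i \notin U) 'X = 'X^(#|~: U|) :> {poly S}.
  by rewrite -prodr_const; apply: eq_bigl => i; rewrite inE.
rewrite coefXn -(eqn_add2l #|U| m) cardsC card_ord.
by case: eqP; rewrite ?mulr1 ?mulr0.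
Qed.

(** * Moving a cycle between a cover and a walk *)

Definition cycle_perm (T : finType) (c : seq T) (Uc : uniq c) : {perm T} :=
  perm (can_inj (prev_next Uc)).

Lemma cycle_permE (T : finType) (c : seq T) (Uc : uniq c) x :
  cycle_perm Uc x = next c x.
Proof. exact: permE. Qed.

Lemma cycle_perm_out (T : finType) (c : seq T) (Uc : uniq c) x :
  x \notin c -> cycle_perm Uc x = x.
Proof. by rewrite cycle_permE next_nth => /negPf->. Qed.

Lemma cycle_perm_on (T : finType) (c : seq T) (Uc : uniq c) :
  perm_on [set x in c] (cycle_perm Uc).
Proof.
by apply/subsetP => x; rewrite !inE; apply: contraNT => /cycle_perm_out->.
Qed.

(** Since [c] avoids the support of [s], the product acts as the cycle on [c]
    and as [s] on [U]. *)
Lemma cover_weight_mul_cycle (R : comPzSemiRingType) (T : finType)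
    (a : T -> T -> R) (U : {set T}) (s : {perm T}) (c : seq T) (Uc : uniq c) :
    perm_on U s -> [disjoint [set x in c] & U] ->
  cover_weight a ([set x in c] :|: U) (cycle_perm Uc * s)%g =
  cover_weight a U s * \prod_(x <- c) a x (next c x).
Proof.
move=> sU dis; rewrite /cover_weight.
rewrite (eq_bigl _ _ (fun x => in_setU x _ _)) bigU //= [RHS]mulrC.
congr (_ * _); last first.
  apply: eq_bigr => x xU; rewrite permM cycle_perm_out //.
  by have := disjointFl dis xU; rewrite inE => ->.
rewrite big_uniq //= (eq_bigl _ _ (fun x => in_set (mem c) x)).
apply: eq_bigr => x xc; rewrite permM cycle_permE (out_perm sU) //.
by rewrite (disjointFr dis) // inE mem_next.
Qed.

(** Converse of [cover_weight_mul_cycle]: dividing a permutation of U by one of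
    its own cycles leaves a permutation of the rest of U. *)
Lemma factor_orbit (T : finType) (U : {set T}) (s : {perm T}) x
    (C := [set y in fingraph.orbit s x]) :
  perm_on U s -> x \in U ->
  C \subset U /\ perm_on (U :\: C) ((cycle_perm (orbit_uniq s x))^-1 * s)%g.
Proof.
move=> sU xU; split.
  apply/subsetP => y; rewrite inE -fconnect_orbit => /iter_findex <-.
  by elim: (findex _ _ _) => //= k IHk; rewrite perm_closed.
apply/subsetP => y; rewrite !inE; apply: contraNT.
rewrite negb_and negbK permM.
set t := cycle_perm _.
have [yC _ | yC /= yU] := boolP (y \in fingraph.orbit s x).
  have ty : t (t^-1%g y) = y by rewrite permKV.
  have := @next_cycle _ _ _ (t^-1%g y) (cycle_orbit (@perm_inj _ s) x).
  rewrite -mem_next -!(cycle_permE (orbit_uniq s x)) -/t ty; exact.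
have ty : t^-1%g y = y.
  by rewrite -[in LHS](cycle_perm_out (orbit_uniq s x) yC) permK.
by rewrite ty (out_perm sU).
Qed.

(** The induction looks for a repetition in the tail first: if there is none,
    the start is the only repeated vertex, so that the closed walk from it to
    its next occurrence is simple. *)
Lemma nonuniq_walk_cycle (T : eqType) (x : T) (p : seq T) :
  ~~ uniq (x :: p) ->
  exists p1 c p2, p = p1 ++ rcons c (last x p1) ++ p2
               /\ uniq (last x p1 :: c).
Proof.
elim: p x => [|y p IHp] x //; rewrite cons_uniq negb_and.
have [Up | nUp _] := boolP (uniq (y :: p)); last first.
  by have [p1 [c [p2 [-> Uc]]]] := IHp y nUp; exists (y :: p1), c, p2.
rewrite orbF negbK => xp; exists [::]; move: Up.
case/splitPr: xp => c p2; rewrite cat_uniq /= => /and3P[Uc].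
rewrite negb_or => /andP[xc _] _.
by exists c, p2; rewrite cat_rcons /= xc.
Qed.

(** The combinatorial core.  The total of #|T| edges is what forces a collision:
    a walk of length k has k + 1 vertices, too many to be distinct and all in
    the complement of U, which has k elements. *)
Lemma swap_cycle (R : comPzSemiRingType) (T : finType) (a : T -> T -> R)
    (U : {set T}) (s : {perm T}) x p :
  perm_on U s -> (#|U| + size p)%N = #|T| ->
  exists V t q, [/\ perm_on V t, (#|V| + size q)%N = #|T|, size q != size p,
    last x q = last x p
    & cover_weight a U s * walk_weight a x p =
      cover_weight a V t * walk_weight a x q].
Proof.
move=> sU size_Up.
(* A covered vertex [v] of the walk lets its cycle be spliced in there. *)
have [/hasP[v vp vU] | /hasPn p_notU] := boolP (has (mem U) (x :: p)).
  have [CU tU] := factor_orbit sU vU.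
  have [c def_c] : exists c, fingraph.orbit s v = v :: c.
    by rewrite /fingraph.orbit -orderSpred; eexists.
  have card_C : #|[set y in fingraph.orbit s v]| = (size c).+1.
    by rewrite cardsE (card_uniqP (orbit_uniq s v)) def_c.
  have weight_C :
      \prod_(y <- fingraph.orbit s v) a y (next (fingraph.orbit s v) y) =
      walk_weight a v (rcons c v).
    by rewrite def_c closed_walk_weight // -def_c orbit_uniq.
  case/splitPl: vp size_Up => p1 p2 last_p1 size_Up.
  exists (U :\: [set y in fingraph.orbit s v]).
  exists ((cycle_perm (orbit_uniq s v))^-1 * s)%g.
  exists (p1 ++ rcons c v ++ p2); split=> //.
  - have := cardsID [set y in fingraph.orbit s v] U.
    move: CU => /setIidPr ->; rewrite card_C -size_Up.
    rewrite !size_cat size_rcons => <-.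
    by rewrite -[RHS]addnA [RHS]addnCA [in RHS](addnCA (size c).+1).
  - by rewrite !size_cat size_rcons; lia.
  - by rewrite !last_cat last_rcons last_p1.
  rewrite !walk_weight_cat last_p1 last_rcons.
  (* [s] is its cycle through [v] times the quotient put in the new cover. *)
  have := @cover_weight_mul_cycle _ _ a _ _ _ (orbit_uniq s v) tU.
  rewrite mulKVg setDE setUIr setUCr setIT (setUidPr CU) -setDE weight_C.
  move=> -> //; first by rewrite -!mulrA; congr (_ * _); exact: mulrCA.
  by rewrite disjoint_sym; apply/setDidPl; rewrite setDDl setUid.
have /nonuniq_walk_cycle[p1 [c [p2 [def_p Uc]]]] : ~~ uniq (x :: p).
  apply/negP => Up.
  have /subset_leq_card : [set y in x :: p] \subset ~: U.
    by apply/subsetP => y; rewrite !inE => /p_notU.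
  rewrite cardsE (card_uniqP Up) /= leqNgt -(ltn_add2l #|U|) cardsC.
  by rewrite -size_Up addnS ltnS leqnn.
set v := last x p1 in def_p Uc.
have dis : [disjoint [set y in v :: c] & U].
  apply/pred0P => y /=; apply/negbTE; rewrite inE negb_and -implybE.
  apply/implyP => yC; apply: p_notU; rewrite def_p -cat_cons mem_cat.
  by rewrite mem_cat mem_rcons yC orbT.
exists ([set y in v :: c] :|: U), (cycle_perm Uc * s)%g, (p1 ++ p2); split.
- apply: perm_onM; last exact: subset_trans sU (subsetUr _ _).
  exact: subset_trans (cycle_perm_on Uc) (subsetUl _ _).
- rewrite cardsU (disjoint_setI0 dis) cards0 subn0 cardsE (card_uniqP Uc).
  by rewrite -size_Up def_p !size_cat size_rcons /=; lia.
- by rewrite def_p !size_cat size_rcons; lia.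
- by rewrite def_p !last_cat last_rcons.
rewrite cover_weight_mul_cycle // -closed_walk_weight // def_p.
rewrite !walk_weight_cat last_rcons -/v -!mulrA; congr (_ * _).
by rewrite mulrCA.
Qed.

Theorem theorem1p1 (S : comNzSemiRingType) (addSS : forall a : S, a + a = a)
    (n : nat) (A : 'M[S]_n.+1) (r : {poly S} * {poly S}) :
  bend_relation (perm_char_poly A) r -> mx_satisfies A r.
Proof.
case=> k fk_nz ->; rewrite /mx_satisfies /= /delete_term.
set f := perm_char_poly A.
have lt_k_f : (k < size f)%N.
  by rewrite ltnNge; apply: contraNN fk_nz => le_f_k; rewrite nth_default.
rewrite -[f in LHS]coefK poly_def (bigD1 (Ordinal lt_k_f)) //= raddfD /=.
apply/matrixP => i j; rewrite mxE.
rewrite raddf_sum summxE horner_mxZ rmorphXn /= horner_mx_X mxE.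
have entry (m : nat) : (horner_mx A (f`_m *: 'X^m)) i j = f`_m * (A ^+ m) i j.
  by rewrite horner_mxZ rmorphXn /= horner_mx_X mxE.
change (le_add (f`_k * (A ^+ k) i j)
  (\sum_(m < size f | m != k :> nat) (horner_mx A (f`_m *: 'X^m)) i j)).
apply: expr_le_walk_weight => p size_p last_p.
rewrite {1}/f coef_perm_char_poly mulr_suml.
apply: le_add_sum => -[s U] /= /andP[sU /eqP card_U].
have [|V [t [q [tV card_V size_q last_q ->]]]] := @swap_cycle _ _ A U s i p sU.
  by rewrite size_p card_ord.
have le_V : le_add (cover_weight A V t) f`_(size q).
  rewrite coef_perm_char_poly.
  apply: (le_sum_term addSS (fun tV => cover_weight A tV.2 tV.1) (i := (t, V))).
  by rewrite /= tV card_V card_ord eqxx.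
have le_q := walk_weight_le_expr addSS A i q.
(* Degrees beyond that of [f] do not occur in the sum, but there the
   coefficient, and with it the monomial, is zero. *)
have [lt_q_f | le_f_q] := ltnP (size q) (size f); last first.
  move: le_V; rewrite nth_default // /le_add addr0 => ->.
  by rewrite mul0r add0r.
apply: le_add_trans (le_add_mul le_V le_q) _.
rewrite last_q last_p -entry.
apply: (le_sum_term addSS (i := Ordinal lt_q_f)
  (fun m : 'I_(size f) => (horner_mx A (f`_m *: 'X^m)) i j)).
by rewrite /= -size_p.
Qed.
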